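(* Let $Q>0$, let $(X,\rho)$ be a complete Ahlfors $Q$-regular metric space, and let $0<\alpha<Q$. Then there exists a closed subset $Y\subseteq X$ such that $(Y,\rho)$, with the restricted metric, is Ahlfors $\alpha$-regular.
   Context: For $s>0$, a metric space $(Z,d)$ is called Ahlfors $s$-regular (or $s$-regular) if it has at least two points and there are constants $0<c<C$ such that $c\,r^s\le \mathcal{H}^s(B(z,r))\le C\,r^s$ for every $z\in Z$ and every real $r$ with $0<r\le \operatorname{diam}(Z)$ (where $\operatorname{diam}(Z)\le\infty$). Here $B(z,r)$ is the metric ball in $Z$ with center $z$ and radius $r$, and $\mathcal{H}^s$ is the $s$-dimensional Hausdorff measure of $(Z,d)$: $\mathcal{H}^s(A)=\lim_{\eta\to0}\inf\{\sum_n \operatorname{diam}(U_n)^s:\ A\subseteq\bigcup_n U_n,\ \operatorname{diam}(U_n)\le\eta\}$, the infimum being over countable covers. *)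

(* Defs.v *)
From HB Require Import structures.
From mathcomp Require Import all_boot all_order all_algebra.
From mathcomp Require Import all_classical all_reals all_analysis.

Set Implicit Arguments.
Unset Strict Implicit.
Unset Printing Implicit Defensive.

Import Order.TTheory GRing.Theory Num.Theory.
Import numFieldNormedType.Exports.

Local Open Scope classical_set_scope.
Local Open Scope ring_scope.

(* The restricted metric. MathComp-Analysis already makes [set_type A] a
   pseudometric space whose balls are the traces of the balls of [T]; the
   instance below adds the distance to that structure. *)
Section restricted_metric.
Context {R : realType} {T : metricType R} (A : set T).

Let sub_mdist (x y : set_type A) : R := mdist (\val x) (\val y).

Let sub_mdist_ge0 x y : 0 <= sub_mdist x y.
Proof. exact: mdist_ge0. Qed.

Let sub_mdist_positivity x y : sub_mdist x y = 0 -> x = y.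
Proof. by move=> /mdist_positivity /val_inj. Qed.

Let sub_ballEmdist (x : set_type A) (d : R) :
  ball x d = [set y | sub_mdist x y < d].
Proof. by rewrite -initial_ballE ballEmdist. Qed.

HB.instance Definition _ := @PseudoMetric_isMetric.Build R (set_type A)
  sub_mdist sub_mdist_ge0 sub_mdist_positivity sub_ballEmdist.

End restricted_metric.

(* The axiom of the library's [Complete] structure, without the base point
   which that structure also carries. *)
Definition complete_space (T : uniformType) : Prop :=
  forall F : set_system T, ProperFilter F -> cauchy F ->
    exists l : T, F --> l.

Section hausdorff.
Context {R : realType} {T : metricType R}.
Local Open Scope ereal_scope.

(* Adjoining 0 makes the diameter of the empty set 0 instead of -oo. *)
Definition diam (A : set T) : \bar R :=
  ereal_sup (0 |` [set (mdist p.1 p.2)%:E | p in A `*` A]).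

(* Countable covers are sequences: a finite one is padded with empty sets, which
   contribute nothing to the sum as long as 0 < s. *)
Definition hausdorff_premeasure (s : R) (A : set T) (eta : R) : \bar R :=
  ereal_inf [set \sum_(0 <= n <oo) (diam (U n) `^ s) | U in
    [set U : (set T)^nat |
      A `<=` \bigcup_n U n /\ forall n, diam (U n) <= eta%:E]].

Definition hausdorff_measure (s : R) (A : set T) : \bar R :=
  lim (hausdorff_premeasure s A eta @[eta --> 0^'+]).

End hausdorff.

(* Intended for 0 < s. [ball z r] is the open ball. *)
Definition ahlfors_regular (R : realType) (T : metricType R) (s : R) : Prop :=
  (exists x y : T, x <> y) /\
  exists c C : R, 0 < c /\ c < C /\
    forall (z : T) (r : R), 0 < r -> (r%:E <= diam [set: T])%E ->
      ((c * r `^ s)%:E <= hausdorff_measure s (ball z r) <= (C * r `^ s)%:E)%E.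

(* Main.v *)
Require Import Defs.
From mathcomp Require Import all_boot all_order all_algebra.
From mathcomp Require Import all_classical all_reals all_analysis.
From mathcomp Require Import ring lra.

(** Choose an integer N and a ratio lam with N * lam^alpha = 1.  Since alpha < Q,
    the Q-regularity of X lets every ball of radius r/2 contain N points that are
    4 * lam * r apart, provided N is large: fewer than N balls of radius
    4 * lam * r cannot cover it.  Iterating yields an N-ary tree of points, and Y
    is the set of points lying within r_k = r_0 * lam^k of some vertex of level k,
    for every k.  Level-k cylinders have diameter at most 2 r_k and are 2 r_k apart.
    Covering a cylinder by its descendants bounds its alpha-measure from above.
    For the lower bound, the base-N expansion sends t in [0,1[ to a point y_t of Y
    with |s - t| <= K d(y_s, y_t)^alpha, so a cover of a level-k cylinder pulls back
    to a cover of an interval of length N^-k, and countable subadditivity of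
    the Lebesgue measure concludes. *)

Local Open Scope classical_set_scope.
Local Open Scope ring_scope.

Set Implicit Arguments.
Unset Strict Implicit.
Unset Printing Implicit Defensive.

Import Order.TTheory GRing.Theory Num.Theory.

(** * Diameter and Hausdorff measure *)

Section hausdorff_facts.
Context {R : realType} {T : metricType R}.
Local Open Scope ereal_scope.

Lemma diam_ge0 (A : set T) : 0 <= diam A.
Proof. by apply: ereal_sup_ubound; left. Qed.

Lemma le_mdist_diam (A : set T) x y : A x -> A y -> (mdist x y)%:E <= diam A.
Proof.
by move=> Ax Ay; apply: ereal_sup_ubound; right; exists (x, y).
Qed.

Lemma diam_le (A : set T) (e : R) : (0 <= e)%R ->
  (forall x y, A x -> A y -> (mdist x y <= e)%R) -> diam A <= e%:E.
Proof.
move=> e0 Ae; apply: ge_ereal_sup => _ [->|[[x y] /= [Ax Ay] <-]].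
  by rewrite lee_fin.
by rewrite lee_fin; exact: Ae.
Qed.

Lemma diam0 : diam (@set0 T) = 0.
Proof. by apply/eqP; rewrite eq_le diam_ge0 andbT; apply: diam_le. Qed.

(** A smaller [eta] admits fewer covers, so the right limit at 0 is a supremum. *)
Lemma hausdorff_measureE (s : R) (A : set T) :
  hausdorff_measure s A =
  ereal_sup [set hausdorff_premeasure s A eta | eta in `]0%R, +oo[].
Proof.
apply/cvg_lim => //; apply: nonincreasing_at_right_cvge => // x y _ _ xy.
apply: ereal_inf_le_tmp => _ [U [AU Ux] <-]; exists U => //; split => // n.
by rewrite (le_trans (Ux n))// lee_fin.
Qed.

Lemma hausdorff_premeasure_le (s : R) (A : set T) (eta : R) : (0 < eta)%R ->
  hausdorff_premeasure s A eta <= hausdorff_measure s A.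
Proof.
move=> eta0; rewrite hausdorff_measureE; apply: ereal_sup_ubound.
by exists eta => //=; rewrite in_itv/= eta0.
Qed.

Lemma hausdorff_measure_le (s : R) (A : set T) M :
  (forall eta : R, (0 < eta)%R -> hausdorff_premeasure s A eta <= M) ->
  hausdorff_measure s A <= M.
Proof.
move=> AM; rewrite hausdorff_measureE; apply: ge_ereal_sup => _ [e /= e0 <-].
by apply: AM; move: e0; rewrite in_itv/= andbT.
Qed.

Lemma hausdorff_premeasure_sub (s : R) (A B : set T) (eta : R) : A `<=` B ->
  hausdorff_premeasure s A eta <= hausdorff_premeasure s B eta.
Proof.
move=> AB; apply: ereal_inf_le_tmp => _ [U [BU Ue] <-]; exists U => //.
by split => //; exact: subset_trans BU.
Qed.

Lemma hausdorff_measure_sub (s : R) (A B : set T) : A `<=` B ->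
  hausdorff_measure s A <= hausdorff_measure s B.
Proof.
move=> AB; apply: hausdorff_measure_le => eta eta0.
exact: le_trans (hausdorff_premeasure_sub _ _ AB) (hausdorff_premeasure_le _ _ eta0).
Qed.

Lemma hausdorff_premeasure_ge0 (s : R) (A : set T) (eta : R) :
  0 <= hausdorff_premeasure s A eta.
Proof.
by apply: le_ereal_inf_tmp => _ [U _ <-]; apply: nneseries_ge0 => n _ _; exact: poweR_ge0.
Qed.

Lemma hausdorff_premeasure_finite_cover (s : R) (A : set T) (eta : R) n
    (U : (set T)^nat) : (0 < s)%R -> (0 <= eta)%R ->
  A `<=` \bigcup_(i < n) U i -> (forall i, (i < n)%N -> diam (U i) <= eta%:E) ->
  hausdorff_premeasure s A eta <= \sum_(0 <= i < n) diam (U i) `^ s.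
Proof.
move=> s0 eta0 AU Ueta; apply: ereal_inf_lbound.
exists (fun i => if (i < n)%N then U i else set0).
  split=> [x /AU[i /= ni Uix]|i]; first by exists i => //; rewrite ni.
  by case: ifPn => [/Ueta//|_]; rewrite diam0 lee_fin.
rewrite (nneseries_split _ n); last by move=> *; exact: poweR_ge0.
rewrite add0n eseries0 ?adde0.
  by apply: eq_big_nat => i /andP[_ ->].
by move=> i ni _; rewrite ltnNge ni/= diam0 poweR0r// gt_eqF.
Qed.

(** When both terms are finite, covers within [e / 2] of optimal are interleaved into the single
    sequence [W]. *)
Lemma hausdorff_premeasureU (s : R) (A B : set T) (eta : R) :
  hausdorff_premeasure s (A `|` B) eta <=
  hausdorff_premeasure s A eta + hausdorff_premeasure s B eta.
Proof.
apply/lee_addgt0Pr => e e0.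
have [/eqP ->|fA] := boolP (hausdorff_premeasure s A eta == +oo).
  by rewrite !addye ?leey// gt_eqF// (lt_le_trans _ (hausdorff_premeasure_ge0 _ _ _)).
have [/eqP ->|fB] := boolP (hausdorff_premeasure s B eta == +oo).
  rewrite addey ?addye ?leey// gt_eqF//.
  by rewrite (lt_le_trans _ (hausdorff_premeasure_ge0 _ _ _)).
have finA : hausdorff_premeasure s A eta \is a fin_num.
  by rewrite ge0_fin_numE ?hausdorff_premeasure_ge0// ltey.
have finB : hausdorff_premeasure s B eta \is a fin_num.
  by rewrite ge0_fin_numE ?hausdorff_premeasure_ge0// ltey.
have e20 : (0 < e / 2)%R by rewrite divr_gt0.
have [_ [U [AU Ue] <-] Ul] := lb_ereal_inf_adherent e20 finA.
have [_ [V [BV Ve] <-] Vl] := lb_ereal_inf_adherent e20 finB.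
pose W n := if odd n then V n./2 else U n./2.
apply: (@le_trans _ _ (\sum_(0 <= n <oo) diam (U n) `^ s +
                       \sum_(0 <= n <oo) diam (V n) `^ s)); last first.
  apply: le_trans (leeD (ltW Ul) (ltW Vl)) _.
  by rewrite addeACA -EFinD -splitr.
apply: ge_ereal_inf; exists (\sum_(0 <= n <oo) diam (W n) `^ s).
  exists W => //; split=> [x [/AU[i _ Uix]|/BV[i _ Vix]]|n].
  - by exists i.*2 => //; rewrite /W odd_double doubleK.
  - by exists i.*2.+1 => //; rewrite /W /= odd_double /= uphalf_double.
  - by rewrite /W; case: ifPn.
apply: lime_le; first by apply: is_cvg_nneseries => *; exact: poweR_ge0.
apply: nearW => n.
have WE m : \sum_(0 <= i < m.*2) diam (W i) `^ s =
    \sum_(0 <= i < m) diam (U i) `^ s + \sum_(0 <= i < m) diam (V i) `^ s.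
  elim: m => [|m IH]; first by rewrite !big_geq ?adde0.
  rewrite doubleS 2?big_nat_recr//= IH 2?big_nat_recr//=.
  by rewrite /W /= odd_double /= doubleK uphalf_double -addeA addeACA.
apply: (@le_trans _ _ (\sum_(0 <= i < n.*2) diam (W i) `^ s)).
  apply: lee_sum_nneg_natr => //; first by move=> *; exact: poweR_ge0.
  by rewrite -addnn leq_addr.
rewrite WE; apply: leeD; apply: nneseries_lim_ge => *; exact: poweR_ge0.
Qed.

Lemma hausdorff_measureU (s : R) (A B : set T) :
  hausdorff_measure s (A `|` B) <= hausdorff_measure s A + hausdorff_measure s B.
Proof.
apply: hausdorff_measure_le => eta eta0.
apply: le_trans (hausdorff_premeasureU _ _ _ _) _.
by apply: leeD; exact: hausdorff_premeasure_le.
Qed.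

Lemma hausdorff_measure_bigcup (s : R) n (A : (set T)^nat) (M : R) : (0 < s)%R ->
  (forall i, (i < n)%N -> hausdorff_measure s (A i) <= M%:E) ->
  hausdorff_measure s (\bigcup_(i < n) A i) <= (M *+ n)%:E.
Proof.
move=> s0; elim: n => [_|n IH AM].
  rewrite bigcup_mkord big_ord0 mulr0n; apply: hausdorff_measure_le => eta eta0.
  have := @hausdorff_premeasure_finite_cover s set0 eta 0 (fun=> set0) s0 (ltW eta0).
  by rewrite big_geq//; apply.
rewrite bigcup_mkord big_ord_recr/= -bigcup_mkord mulrSr EFinD.
apply: le_trans (hausdorff_measureU _ _ _) _.
by apply: leeD; [apply: IH => i ni; apply: AM; exact: ltnW|exact: AM].
Qed.

End hausdorff_facts.

(** * Separated points, the ratio and the tree of vertices *)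

Lemma separated_family {R : realType} {X : metricType R} (Q c C : R) :
  0 < Q -> 0 < C ->
  (forall (z : X) (r : R), 0 < r -> (r%:E <= diam [set: X])%E ->
    ((c * r `^ Q)%:E <= hausdorff_measure Q (ball z r) <= (C * r `^ Q)%:E)%E) ->
  forall (x : X) (r e : R) (n : nat), 0 < r -> (r%:E <= diam [set: X])%E ->
  0 < e -> (e%:E <= diam [set: X])%E -> n%:R * (C * e `^ Q) < c * r `^ Q ->
  exists f : nat -> X, (forall i, (i < n)%N -> mdist x (f i) < r) /\
    (forall i j, (i < j < n)%N -> e <= mdist (f i) (f j)).
Proof.
move=> Q0 C0 reg x r e n r0 rX e0 eX nCe.
have: (n <= n)%N by [].
(* Greedy choice: the number [m] of chosen points grows while the measure hypothesis keeps the fixed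
   [n]. *)
elim: {1 3 4}n => [_|m IH mn].
  by exists (fun=> x); split => // i j; rewrite ltn0 andbF.
have [f [fr fe]] := IH (ltnW mn).
suff [y xy yf] : exists2 y, mdist x y < r & forall i, (i < m)%N -> e <= mdist (f i) y.
  exists (fun i => if (i < m)%N then f i else y); split => [i _|i j /andP[ij]].
    by case: ifPn => // im; exact: fr.
  rewrite ltnS => jm; rewrite (leq_trans ij jm).
  case: ifPn => jm'; last exact/yf/(leq_trans ij jm).
  by apply: fe; rewrite ij.
(* Without such a [y], the [m] balls of radius [e] cover [ball x r], against the measure bounds. *)
apply: contrapT => H.
have cov : ball x r `<=` \bigcup_(i < m) ball (f i) e.
  move=> y; rewrite ballEmdist /= => xy; apply: contrapT => ny.
  apply: H; exists y => // i im; rewrite leNgt; apply/negP => fy.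
  by apply: ny; exists i => //; rewrite ballEmdist.
have /andP[lo _] := reg x r r0 rX.
have := le_trans lo (hausdorff_measure_sub Q cov).
rewrite leNgt => /negP; apply.
have up i : (i < m)%N -> (hausdorff_measure Q (ball (f i) e) <= (C * e `^ Q)%:E)%E.
  by move=> _; have /andP[] := reg (f i) e e0 eX.
apply: le_lt_trans (hausdorff_measure_bigcup Q0 up) _.
rewrite lte_fin -mulr_natl; apply: le_lt_trans nCe.
by rewrite ler_wpM2r// ?ler_nat 1?ltnW// mulr_ge0 ?powR_ge0// ltW.
Qed.

(** For lam = N^(-1/alpha), N lam^Q is lam^(Q - alpha), which is small for large N because alpha <
    Q. *)
Lemma exists_similarity_ratio {R : realType} (alpha Q b : R) :
  0 < alpha -> alpha < Q -> 0 < b ->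
  exists (N : nat) (lam : R), [/\ (1 < N)%N, 0 < lam, lam <= 4^-1,
    N%:R * lam `^ alpha = 1 & N%:R * lam `^ Q < b].
Proof.
move=> a0 aQ b0; have Qa0 : 0 < Q - alpha by rewrite subr_gt0.
(* Below [l0], both lam <= 1/4 and lam^(Q - alpha) < b hold. *)
pose l0 := Num.min 4^-1 (b `^ (Q - alpha)^-1).
have l00 : 0 < l0 by rewrite lt_min invr_gt0 powR_gt0 // ltr0n.
(* One successor makes N exceed l0^(-alpha), the other makes it at least 2. *)
pose N := (Num.truncn ((l0 `^ alpha)^-1)).+2.
have NL : (l0 `^ alpha)^-1 < N%:R.
  by apply: lt_le_trans (truncnS_gt _) _; rewrite ler_nat.
pose lam : R := N%:R `^ (- alpha^-1).
have lam0 : 0 < lam by rewrite powR_gt0// ltr0n.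
have lamE : lam `^ alpha = N%:R^-1.
  by rewrite -powRrM mulNr mulVf ?gt_eqF// powR_inv1// ler0n.
have laml0 : lam < l0.
  rewrite ltNge; apply/negP => /(ge0_ler_powR (ltW a0)).
  rewrite !nnegrE lamE => /(_ (ltW l00) (ltW lam0)).
  by rewrite leNgt invf_plt ?NL// posrE ?ltr0n// powR_gt0.
have NN : N%:R * lam `^ alpha = 1 by rewrite lamE mulfV// pnatr_eq0.
exists N, lam; split => //.
  by apply: le_trans (ltW laml0) _; rewrite ge_min lexx.
rewrite -[Q](subrK alpha) powRD; last by rewrite (gt_eqF lam0) implybT.
rewrite mulrCA NN mulr1.
apply: (@lt_le_trans _ _ (l0 `^ (Q - alpha))).
  by apply: gt0_ltr_powR => //; rewrite nnegrE ltW.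
apply: (@le_trans _ _ ((b `^ (Q - alpha)^-1) `^ (Q - alpha))).
  apply: ge0_ler_powR; rewrite ?nnegrE ?(ltW Qa0) ?(ltW l00) ?powR_ge0//.
  by rewrite ge_min lexx orbT.
by rewrite -powRrM mulVf ?gt_eqF// powRr1// ltW.
Qed.

(** Siblings are separated by the choice of children. For distinct parents, 4 r_k less two moves of
    r_k / 2 leaves 3 r_k, more than 4 r_(k+1). *)
Lemma exists_tree {R : realType} {X : metricType R} (N : nat) (r : nat -> R) (x0 : X) :
  (0 < N)%N -> (forall k, 0 < r k) -> (forall k, 4 * r k.+1 <= r k) ->
  (forall k (x : X), exists f : nat -> X,
    (forall i, (i < N)%N -> mdist x (f i) < r k / 2) /\
    (forall i j, (i < j < N)%N -> 4 * r k.+1 <= mdist (f i) (f j))) ->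
  exists p : nat -> nat -> X,
    (forall k j, mdist (p k (j %/ N)%N) (p k.+1 j) <= r k / 2) /\
    (forall k i j, (i < N ^ k)%N -> (j < N ^ k)%N -> i != j ->
      4 * r k <= mdist (p k i) (p k j)).
Proof.
move=> N0 r0 r4 ex.
pose ch k x := projT1 (cid (ex k x)).
have ch1 k x i : (i < N)%N -> mdist x (ch k x i) < r k / 2.
  by rewrite /ch; case: cid => f /= [+ _]; exact.
have ch2 k x i j : (i < N)%N -> (j < N)%N -> i != j ->
    4 * r k.+1 <= mdist (ch k x i) (ch k x j).
  rewrite /ch; case: cid => f /= [_ fP] iN jN.
  by rewrite neq_ltn => /orP[ij|ij]; [|rewrite metric_sym]; apply: fP; rewrite ij.
pose p := fix p k j := if k is k'.+1 then ch k' (p k' (j %/ N)%N) (j %% N)%N else x0.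
have p1 k j : mdist (p k (j %/ N)%N) (p k.+1 j) <= r k / 2.
  by apply/ltW/ch1; rewrite ltn_mod.
exists p; split => //; elim=> [i j|k IH i j].
  by rewrite expn0 !ltnS !leqn0 => /eqP-> /eqP->.
rewrite expnSr => iN jN ij.
have [e|ne] := eqVneq (i %/ N)%N (j %/ N)%N.
  rewrite /= e; apply: ch2; rewrite ?ltn_mod//.
  by apply: contra ij => /eqP e'; rewrite (divn_eq i N) (divn_eq j N) e e'.
have := IH (i %/ N)%N (j %/ N)%N.
rewrite !ltn_divLR// => /(_ iN jN ne) d4.
have d1 := p1 k i; have d2 := p1 k j.
have t1 := metric_triangle (p k (i %/ N)%N) (p k.+1 i) (p k (j %/ N)%N).
have t2 := metric_triangle (p k.+1 i) (p k.+1 j) (p k (j %/ N)%N).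
rewrite (metric_sym (p k.+1 j)) in t2.
have := r4 k; have := r0 k; move: d1 d2 d4 t1 t2.
move: (mdist _ _) (mdist _ _) (mdist _ _) (mdist _ _) (mdist _ _) => *; lra.
Qed.

Lemma powR_div {R : realType} (a b x : R) : 0 <= a -> 0 <= b ->
  (a / b) `^ x = a `^ x / b `^ x.
Proof.
move=> a0 b0; rewrite powRM ?invr_ge0// -[in LHS](powR_inv1 b0) powRAC.
by rewrite powR_inv1 ?powR_ge0.
Qed.

(** The increments telescope, so the tail of [u] from [k] on, and hence the limit, stays within
    [r k] of [u k]. *)
Lemma complete_limit {R : realType} {X : metricType R} (u : nat -> X) (r : nat -> R) :
  complete_space X -> (forall k, 0 <= r k) ->
  (forall e, 0 < e -> exists k, r k < e) ->
  (forall k, mdist (u k) (u k.+1) <= r k - r k.+1) ->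
  exists l, forall k, mdist (u k) l <= r k.
Proof.
move=> Xc r0 rs ur.
have tele k m : mdist (u k) (u (k + m)%N) <= r k - r (k + m)%N.
  elim: m => [|m IH]; first by rewrite addn0 mdistxx subrr.
  rewrite addnS; apply: le_trans (metric_triangle _ (u (k + m)%N) _) _.
  by have := ur (k + m)%N; move: IH; lra.
have le k n : (k <= n)%N -> mdist (u k) (u n) <= r k.
  move=> kn; rewrite -(subnKC kn); apply: le_trans (tele _ _) _.
  by have := r0 (k + (n - k))%N; lra.
have [l ul] : exists l : X, u @ \oo --> l.
  apply: Xc; have /cauchy_exP : cauchy_ex (u @ \oo); last exact.
  move=> e e0; have [k rke] := rs e e0; exists (u k).
  exists k => // n /= kn; rewrite ballEmdist /=.
  exact: le_lt_trans (le _ _ kn) rke.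
exists l => k; apply/ler_addgt0Pr => e e0.
move/cvg_ballP : ul => /(_ e e0) [m _ /(_ (maxn k m))] /=.
rewrite leq_maxr ballEmdist /= => /(_ isT) le'.
apply: le_trans (metric_triangle _ (u (maxn k m)) _) _.
apply: lerD; first by apply: le; rewrite leq_maxl.
by rewrite metric_sym ltW.
Qed.

Lemma closed_le_mdist {R : realType} {X : metricType R} (x : X) (e : R) :
  closed [set y | mdist x y <= e].
Proof.
rewrite -[X in closed X]setCK; apply: open_closedC.
rewrite openE => y /= /negP; rewrite -ltNge => exy.
apply/nbhs_ballP; exists (mdist x y - e) => /=; first by rewrite subr_gt0.
move=> z; rewrite ballEmdist /= => yz; apply/negP; rewrite -ltNge.
have := metric_triangle x z y; rewrite (metric_sym z y); lra.
Qed.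

(** * The Cantor set, its cylinders and the upper bound *)

Section cantor_set.
Context {R : realType} {X : metricType R}.
Variables (N : nat) (alpha : R) (r : nat -> R) (p : nat -> nat -> X).
Hypothesis N1 : (1 < N)%N.
Hypothesis alpha0 : 0 < alpha.
Hypothesis r0 : forall k, 0 < r k.
Hypothesis r4 : forall k, 4 * r k.+1 <= r k.
Hypothesis rN : forall k, N%:R * r k.+1 `^ alpha = r k `^ alpha.
Hypothesis p_child : forall k j, mdist (p k (j %/ N)%N) (p k.+1 j) <= r k / 2.
Hypothesis p_sep : forall k i j, (i < N ^ k)%N -> (j < N ^ k)%N -> i != j ->
  4 * r k <= mdist (p k i) (p k j).

(* [p k j] is the [j]-th vertex of level [k]; only [j < N ^ k] is meaningful, and
   the parent of [p k.+1 j] is [p k (j %/ N)]. *)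
Definition cantor_set : set X :=
  [set y | forall k, exists2 j, (j < N ^ k)%N & mdist (p k j) y <= r k].

(** Cylinders live in the subtype, so that their diameter and measure refer to the restricted
    metric. *)
Definition cylinder k j : set (set_type cantor_set) :=
  [set y | mdist (p k j) (val y) <= r k].

Lemma Nexp_gt0 k : (0 < N ^ k)%N.
Proof. by rewrite expn_gt0 (ltnW N1). Qed.

Lemma scale_small e : 0 < e -> exists k, r k < e.
Proof.
(* Decay like 1/(k + 1) is enough; it follows from k + 2 <= 4 (k + 1). *)
move=> e0; have rk k : r k * k.+1%:R <= r 0%N.
  elim: k => [|k IH]; first by rewrite mulr1.
  apply: le_trans IH; have := r4 k; have := r0 k.+1.
  have : (0 : R) <= k%:R by rewrite ler0n.
  rewrite -[k.+2]addn2 -[k.+1 in X in _ -> _ -> _ -> _ <= X]addn1 !natrD.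
  by nra.
exists (Num.truncn (r 0%N / e)).
have := truncnS_gt (r 0%N / e).
rewrite ltr_pdivrMr// => h.
have := le_lt_trans (rk (Num.truncn (r 0%N / e))) h.
by rewrite [_%:R * e]mulrC ltr_pM2r// ltr0n.
Qed.

Lemma scale_powR k : (N ^ k)%:R * r k `^ alpha = r 0%N `^ alpha.
Proof.
elim: k => [|k IH]; first by rewrite expn0 mul1r.
by rewrite expnSr natrM -mulrA rN.
Qed.

Lemma scale_powRD k m : (N ^ m)%:R * r (k + m)%N `^ alpha = r k `^ alpha.
Proof.
elim: m => [|m IH]; first by rewrite expn0 mul1r addn0.
by rewrite expnSr natrM -mulrA addnS rN.
Qed.

Lemma closed_cantor_set : closed cantor_set.
Proof.
have -> : cantor_set = \bigcap_k \bigcup_(j in `I_(N ^ k)) [set y | mdist (p k j) y <= r k].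
  apply/seteqP; split => y /=.
    by move=> yC k _; have [j jN jy] := yC k; exists j.
  by move=> yC k; have [j jN jy] := yC k I; exists j.
apply: closed_bigI => k _; apply: closed_bigcup => // j _; exact: closed_le_mdist.
Qed.

(** The triangle inequality takes one r_k at each end from the distance 4 r_k of the vertices. *)
Lemma address_sep k i j y z : (i < N ^ k)%N -> (j < N ^ k)%N -> i != j ->
  mdist (p k i) y <= r k -> mdist (p k j) z <= r k -> 2 * r k <= mdist y z.
Proof.
move=> iN jN /(p_sep iN jN) ij iy jz.
have := metric_triangle (p k i) y (p k j); have := metric_triangle y z (p k j).
rewrite (metric_sym z); lra.
Qed.

Lemma address_unique k i j y : (i < N ^ k)%N -> (j < N ^ k)%N ->
  mdist (p k i) y <= r k -> mdist (p k j) y <= r k -> i = j.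
Proof.
move=> iN jN iy jy; apply/eqP; apply/negPn/negP => ij.
have := address_sep iN jN ij iy jy; rewrite mdistxx; have := r0 k; lra.
Qed.

(** Closed balls about the vertices are nested along branches, since r_k / 2 + r_(k+1) <= 3/4
    r_k. *)
Lemma address_ancestor k m j y : mdist (p (k + m) j) y <= r (k + m)%N ->
  mdist (p k (j %/ N ^ m)%N) y <= r k.
Proof.
elim: m j => [|m IH] j; first by rewrite addn0 expn0 divn1.
rewrite addnS expnS divnMA => jy; apply: IH.
have := metric_triangle (p (k + m) (j %/ N)%N) (p (k + m).+1 j) y.
have := p_child (k + m) j; have := r4 (k + m); have := r0 (k + m); lra.
Qed.

Lemma same_cylinder k j (y z : set_type cantor_set) : (j < N ^ k)%N ->
  cylinder k j y -> mdist y z < 2 * r k -> cylinder k j z.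
Proof.
move=> jN yj yz; have [i iN zi] := set_valP z k.
have [<-//|ij] := eqVneq i j.
have := address_sep iN jN ij zi yj; rewrite metric_sym leNgt => /negP; case.
exact: yz.
Qed.

Lemma diam_cylinder k j : (diam (cylinder k j) <= (2 * r k)%:E)%E.
Proof.
apply: diam_le; first by rewrite mulr_ge0// ltW.
move=> y z yj zj; apply: le_trans (metric_triangle _ (p k j) _ : mdist (val y) (val z) <= _) _.
rewrite (metric_sym (val y)); move: yj zj; rewrite /cylinder /=; lra.
Qed.

(** The descendants of [j] after [m] levels have indices j N^m + i; uniqueness of addresses makes
    [j] the ancestor of the address of [y]. *)
Lemma cylinder_split k m j : (j < N ^ k)%N ->
  cylinder k j `<=` \bigcup_(i < N ^ m) cylinder (k + m) (j * N ^ m + i)%N.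
Proof.
move=> jN y yj; have [j' jN' yj'] := set_valP y (k + m)%N.
have jE : (j' %/ N ^ m)%N = j.
  apply: address_unique jN (address_ancestor yj') yj.
  by rewrite ltn_divLR ?Nexp_gt0// -expnD.
exists (j' %% N ^ m)%N; first by rewrite /= ltn_mod Nexp_gt0.
by rewrite -jE /cylinder/= -divn_eq.
Qed.

(** The N^n descendants at level k + n contribute at most N^n (2 r_(k+n))^alpha, which is (2
    r_k)^alpha for every n. *)
Lemma hausdorff_cylinder_le k j : (j < N ^ k)%N ->
  (hausdorff_measure alpha (cylinder k j) <= ((2 * r k) `^ alpha)%:E)%E.
Proof.
move=> jN; apply: hausdorff_measure_le => eta eta0.
have [n rn] : exists n, r n < eta / 2 by apply: scale_small; rewrite divr_gt0.
have r_le i m : r (i + m)%N <= r i.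
  elim: m => [|m IH]; first by rewrite addn0.
  rewrite addnS; have := r4 (i + m)%N; have := r0 (i + m).+1; move: IH; lra.
have rkn : 2 * r (k + n)%N <= eta by have := r_le n k; rewrite addnC; lra.
apply: le_trans (hausdorff_premeasure_finite_cover alpha0 (ltW eta0)
  (cylinder_split n jN) _) _.
  by move=> i _; apply: le_trans (diam_cylinder _ _) _; rewrite lee_fin.
apply: (@le_trans _ _ (\sum_(0 <= i < N ^ n) ((2 * r (k + n)%N) `^ alpha)%:E)%E).
  apply: lee_sum => i _; rewrite -poweR_EFin.
  have ge := @diam_ge0 _ _ (cylinder (k + n) (j * N ^ n + i)).
  apply: gt0_ler_poweR (diam_cylinder _ _); rewrite ?(ltW alpha0)//.
    by rewrite in_itv/= ge leey.
  by rewrite in_itv/= leey andbT lee_fin mulr_ge0// ltW.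
rewrite sumEFin lee_fin sumr_const_nat subn0 -[_ *+ (N ^ n)]mulr_natl.
by rewrite !powRM ?(ltW (r0 _))// mulrCA scale_powRD.
Qed.


(** * Base-N coding and the lower bound *)

Hypothesis Xc : complete_space X.

(* The first [k] base-[N] digits of [t] are those of [truncn (N ^ k * t)]. *)
Definition coding (t : R) (y : set_type cantor_set) : Prop :=
  forall k, cylinder k (Num.truncn ((N ^ k)%:R * t)) y.

Lemma NexpR_gt0 k : 0 < (N ^ k)%:R :> R.
Proof. by rewrite ltr0n Nexp_gt0. Qed.

(** Dropping the last base-N digit of [t] is passing to the parent vertex. *)
Lemma truncn_divN k (t : R) : 0 <= t ->
  (Num.truncn ((N ^ k.+1)%:R * t) %/ N)%N = Num.truncn ((N ^ k)%:R * t).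
Proof.
move=> t0; have Nt0 : 0 <= (N ^ k.+1)%:R * t by rewrite mulr_ge0// ltW// NexpR_gt0.
have N0 : 0 < N%:R :> R by rewrite ltr0n (ltnW N1).
apply/esym/truncn_def; have /andP[le lt] := truncn_itv Nt0.
set j := Num.truncn _ in le lt *.
have NE : (N ^ k.+1)%:R * t = (N ^ k)%:R * t * N%:R by rewrite expnSr natrM mulrAC.
rewrite NE in le lt; apply/andP; split.
  rewrite -(ler_pM2r N0) -natrM; apply: le_trans le.
  by rewrite ler_nat leq_divM.
rewrite -(ltr_pM2r N0) -natrM; apply: lt_le_trans lt _.
by rewrite ler_nat ltn_ceil// ltnW.
Qed.

Lemma truncn_lt_expN k (t : R) : 0 <= t < 1 -> (Num.truncn ((N ^ k)%:R * t) < N ^ k)%N.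
Proof.
move=> /andP[t0 t1]; rewrite truncn_lt_nat ?mulr_ge0//.
by rewrite -[X in _ < X]mulr1 ltr_pM2l// NexpR_gt0.
Qed.

(** Steps down the branch given by the digits of [t] are at most r_k / 2 <= r_k - r_(k+1), so
    [complete_limit] applies. *)
Lemma coding_total t : 0 <= t < 1 -> exists y, coding t y.
Proof.
move=> t01; have /andP[t0 t1] := t01.
have [|y yt] := @complete_limit _ _ (fun k => p k (Num.truncn ((N ^ k)%:R * t))) r Xc
    (fun k => ltW (r0 k)) scale_small.
  move=> k; have := p_child k (Num.truncn ((N ^ k.+1)%:R * t)).
  rewrite truncn_divN//; have := r4 k; have := r0 k; have := r0 k.+1; lra.
have yC : cantor_set y.
  by move=> k; exists (Num.truncn ((N ^ k)%:R * t)) => //; exact: truncn_lt_expN.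
by exists (exist _ y (mem_set yC)).
Qed.

Lemma truncn_eq_dist (a b : R) : 0 <= a -> 0 <= b ->
  Num.truncn a = Num.truncn b -> `|a - b| < 1.
Proof.
move=> /truncn_itv/andP[a1 a2] /truncn_itv/andP[b1 b2] ab.
move: a1 a2; rewrite ab -[_.+1]addn1 in b2 * => a1 a2.
by move: a1 a2 b1 b2; rewrite !natrD ltr_norml; lra.
Qed.

(** Let n + 1 be the first level where the addresses differ. Agreement at level n gives |s - t| <
    N^(-n), the difference at level n + 1 gives d(y, z) >= 2 r_(n+1), and N (r_(n+1) / r_0)^alpha is
    N^(-n). *)
Lemma coding_holder s t y z : 0 <= s < 1 -> 0 <= t < 1 -> coding s y -> coding t z ->
  `|s - t| <= N%:R * (mdist y z / (2 * r 0)) `^ alpha.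
Proof.
move=> s01 t01 sy tz; have /andP[s0 s1] := s01; have /andP[t0 t1] := t01.
have [->|st] := eqVneq s t.
  by rewrite subrr normr0 mulr_ge0// powR_ge0.
have st0 : 0 < `|s - t| by rewrite normr_gt0 subr_eq0.
have clos k : Num.truncn ((N ^ k)%:R * s) = Num.truncn ((N ^ k)%:R * t) ->
    (N ^ k)%:R * `|s - t| < 1.
  move=> e; rewrite -[X in X * _](ger0_norm (ltW (NexpR_gt0 k))) -normrM mulrBr; move: e.
  by apply: truncn_eq_dist; rewrite mulr_ge0// ltW// NexpR_gt0.
have ex : exists m, Num.truncn ((N ^ m)%:R * s) != Num.truncn ((N ^ m)%:R * t).
  (* The addresses differ once N^m exceeds 1 / |s - t|. *)
  pose m := (Num.truncn (`|s - t|^-1)).+1; exists m.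
  apply/negP => /eqP /clos; rewrite -ltr_pdivlMr// div1r ltNge => /negP; apply.
  by apply: le_trans (ltW (truncnS_gt _)) _; rewrite ler_nat ltnW// ltn_expl.
(* Level 0 is excluded, since both addresses there are 0. *)
case: (ex_minnP ex) => -[|n] nst nmin.
  move: nst; have := truncn_lt_expN 0 s01; have := truncn_lt_expN 0 t01.
  by rewrite expn0 !ltnS !leqn0 => /eqP-> /eqP->.
have /clos lt1 : Num.truncn ((N ^ n)%:R * s) = Num.truncn ((N ^ n)%:R * t).
  by apply/eqP/negPn/negP => /nmin; rewrite ltnn.
have sep := address_sep (truncn_lt_expN _ s01) (truncn_lt_expN _ t01) nst (sy _) (tz _).
apply: (@le_trans _ _ (N%:R * (r n.+1 / r 0%N) `^ alpha)).
  rewrite powR_div ?(ltW (r0 _))// -(scale_powR n.+1) expnS natrM.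
  have -> : N%:R * (r n.+1 `^ alpha / (N%:R * (N ^ n)%:R * r n.+1 `^ alpha)) =
      (N ^ n)%:R^-1.
    have ? : N%:R != 0 :> R by rewrite pnatr_eq0 -lt0n (ltnW N1).
    have ? : (N ^ n)%:R != 0 :> R by rewrite gt_eqF ?NexpR_gt0.
    have ? : r n.+1 `^ alpha != 0 by rewrite gt_eqF ?powR_gt0.
    by field; do ?(apply/andP; split).
  by rewrite -[leRHS]mul1r ler_pdivlMr ?NexpR_gt0// mulrC ltW.
rewrite ler_wpM2l//; apply: ge0_ler_powR; rewrite ?nnegrE ?(ltW alpha0)//.
- by rewrite divr_ge0// ltW.
- by rewrite divr_ge0 ?mdist_ge0// mulr_ge0// ltW.
have -> : r n.+1 / r 0%N = 2 * r n.+1 / (2 * r 0%N).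
  by field; rewrite gt_eqF.
by rewrite ler_wpM2r// invr_ge0 mulr_ge0// ltW.
Qed.

(** Twice the constant of [coding_holder], because an interval of radius e has length 2 e. *)
Definition holder_constant : R := 2 * N%:R / (2 * r 0) `^ alpha.

Lemma holder_constant_gt0 : 0 < holder_constant.
Proof.
rewrite /holder_constant divr_gt0 ?powR_gt0 ?mulr_gt0//.
by rewrite ltr0n (ltnW N1).
Qed.

(** If [U] has finite diameter and contains a coded point, [W] is an interval about its parameter
    with the radius from [coding_holder]. Taking a superset of the preimage sidesteps the
    measurability of the latter. *)
Lemma coding_pullback (U : set (set_type cantor_set)) : exists W : set R,
  [/\ measurable W, forall t y, 0 <= t < 1 -> coding t y -> U y -> W t &
    (lebesgue_measure W <= holder_constant%:E * diam U `^ alpha)%E].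
Proof.
have [[s [x [s01 [sx Ux]]]]|none] := pselect (exists s x, 0 <= s < 1 /\ coding s x /\ U x); last first.
  exists set0; split => // [t y t01 ty Uy|]; first by apply: none; exists t, y.
  by rewrite measure0 mule_ge0 ?poweR_ge0// lee_fin ltW// holder_constant_gt0.
have := @diam_ge0 _ _ U; have := le_mdist_diam Ux.
case: (diam U) => [d| |] // le_d; last first.
  move=> _; exists setT; split => //.
  by rewrite poweRyr ?gt_eqF// gt0_muley ?leey// lte_fin holder_constant_gt0.
rewrite lee_fin => d0; pose e := N%:R * (d / (2 * r 0)) `^ alpha.
have e0 : 0 <= e by rewrite mulr_ge0// powR_ge0.
exists `[s - e, s + e]%classic; split => // [t y t01 ty Uy|].
  rewrite /= in_itv /=.
  suff : `|s - t| <= e by rewrite ler_norml; lra.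
  apply: le_trans (coding_holder s01 t01 sx ty) _.
  rewrite ler_wpM2l//; apply: ge0_ler_powR; rewrite ?nnegrE ?(ltW alpha0)//.
  - by rewrite divr_ge0 ?mdist_ge0// mulr_ge0// ltW.
  - by rewrite divr_ge0 // mulr_ge0// ltW.
  rewrite ler_wpM2r// ?invr_ge0 ?mulr_ge0 ?(ltW (r0 _))//.
  by have := le_d y Uy; rewrite lee_fin.
rewrite lebesgue_measure_itv /=.
have eE : holder_constant * d `^ alpha = e + e.
  by rewrite /e powR_div ?mulr_ge0 ?(ltW (r0 _))// /holder_constant; ring.
case: ifPn => _; last by rewrite -EFinM eE lee_fin addr_ge0.
rewrite -EFinB -EFinM eE lee_fin; lra.
Qed.

Lemma le_hausdorff_cylinder k j : (j < N ^ k)%N ->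
  (((2 * r k) `^ alpha / (2 * N%:R))%:E <= hausdorff_measure alpha (cylinder k j))%E.
Proof.
(* The measure is the supremum of the premeasures, so the scale 1 gives a lower bound. *)
move=> jN; apply: le_trans (hausdorff_premeasure_le _ _ (ltr01 : 0 < 1 :> R)).
apply: le_ereal_inf_tmp => _ [U [jU _] <-].
rewrite -(@lee_pmul2l _ holder_constant%:E) ?lte_fin ?holder_constant_gt0//.
rewrite -nneseriesZl ?lee_fin ?(ltW holder_constant_gt0)//; last by move=> *; exact: poweR_ge0.
have [W WP] := choice (fun n => coding_pullback (U n)).
(* The interval [a, b[ consists of the parameters in [0, 1[ with address [j] at level [k]; its
   length N^(-k) is [holder_constant] times the claimed bound. *)
pose a : R := j%:R / (N ^ k)%:R; pose b : R := j.+1%:R / (N ^ k)%:R.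
have ab : b - a = (N ^ k)%:R^-1 by rewrite /b /a -mulrBl -natrB// subSnn mul1r.
apply: (@le_trans _ _ (lebesgue_measure `[a, b[%classic)).
  rewrite lebesgue_measure_itv /= lte_fin.
  rewrite -subr_gt0 ab invr_gt0 NexpR_gt0 -EFinB ab -EFinM lee_fin.
  rewrite /holder_constant !powRM ?(ltW (r0 _))// -(scale_powR k).
  rewrite le_eqVlt; apply/orP; left; apply/eqP.
  have ? : N%:R != 0 :> R by rewrite pnatr_eq0 -lt0n (ltnW N1).
  have ? : (N ^ k)%:R != 0 :> R by rewrite gt_eqF ?NexpR_gt0.
  have ? : r k `^ alpha != 0 by rewrite gt_eqF ?powR_gt0.
  have ? : 2 `^ alpha != 0 :> R by rewrite gt_eqF ?powR_gt0.
  by field; do ?(apply/andP; split).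
apply: (@le_trans _ _ (\sum_(0 <= n <oo) lebesgue_measure (W n))%E).
  apply: measure_sigma_subadditive => //.
    by move=> n; have [] := WP n.
  move=> t /=; rewrite in_itv /= => /andP[at_ tb].
  have tj : Num.truncn ((N ^ k)%:R * t) = j.
    apply: truncn_def; rewrite mulrC -ler_pdivrMr ?NexpR_gt0// at_/=.
    by rewrite -ltr_pdivlMr ?NexpR_gt0.
  have t01 : 0 <= t < 1.
    rewrite (le_trans _ at_) ?divr_ge0//=; apply: lt_le_trans tb _.
    by rewrite /b ler_pdivrMr ?NexpR_gt0// mul1r ler_nat.
  have [y ty] := coding_total t01.
  have [n _ Uny] : (\bigcup_n U n) y by apply: jU; have := ty k; rewrite tj.
  by exists n => //; have [_ + _] := WP n; apply; [exact: t01|exact: ty|].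
by apply: lee_nneseries => // n _; have [_ _] := WP n.
Qed.

(** * Ahlfors regularity of the Cantor set *)

Lemma ahlfors_regular_cantor_set : ahlfors_regular (set_type cantor_set) alpha.
Proof.
have N0 : 0 < N%:R :> R by rewrite ltr0n (ltnW N1).
split.
  (* The points coded by 0 and 1/N have the distinct addresses 0 and 1 at level 1. *)
  have lt0 : 0 <= (0 : R) < 1 by rewrite lexx /=.
  have ltN : 0 <= (N%:R^-1 : R) < 1 by rewrite invr_ge0 ler0n /= invf_lt1 ?ltr1n.
  have [y y0] := coding_total lt0.
  have [z zN] := coding_total ltN.
  exists y, z => yz; have := y0 1%N; have := zN 1%N.
  rewrite yz expn1 mulr0 mulfV ?gt_eqF// truncn0 truncn1 => z1 z0.
  by have := @address_unique 1 1 0 (val z); rewrite expn1 N1 (ltnW N1) => /(_ isT isT z1 z0).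
have Nge2 : 2 <= N%:R :> R by rewrite ler_nat.
(* For 2 r_(n+1) < e <= 2 r_n, replacing one end by the other costs a factor N in the alpha-power;
   the lower bound on cylinders already carries 2 N. *)
exists (2 * N%:R ^+ 2)^-1, N%:R; split; [|split].
- by rewrite invr_gt0 mulr_gt0// exprn_gt0.
- rewrite invf_plt ?posrE ?mulr_gt0 ?exprn_gt0//.
  apply: (@le_lt_trans _ _ 1); first by rewrite invf_le1//; lra.
  nra.
move=> z e e0 eY.
(* The whole set is the cylinder of level 0; this makes the level chosen below a successor. *)
have e_le : e <= 2 * r 0%N.
  rewrite -lee_fin; apply: le_trans eY (le_trans _ (diam_cylinder 0 0)).
  apply: ereal_sup_le => _ [->|[[x y] /= _ <-]]; [by left|right; exists (x, y) => //=].
  have all0 (w : set_type cantor_set) : cylinder 0 0 w.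
    by have [j] := set_valP w 0%N; rewrite expn0 ltnS leqn0 => /eqP->.
  by split; exact: all0.
have ex : exists k, 2 * r k < e.
  have [k rk] : exists k, r k < e / 2 by apply: scale_small; rewrite divr_gt0.
  by exists k; move: rk; lra.
(* With 2 r_(n+1) < e <= 2 r_n, the ball of radius [e] contains a cylinder of level n + 1 and lies
   in one of level n. *)
case: (ex_minnP ex) => -[|n] rn nmin; first by move: rn; rewrite ltNge e_le.
have rne : e <= 2 * r n.
  by rewrite leNgt; apply/negP => /nmin; rewrite ltnn.
have scl : (2 * r n) `^ alpha = N%:R * (2 * r n.+1) `^ alpha.
  by rewrite !powRM ?(ltW (r0 _))// mulrCA rN.
have mono (a b : R) : 0 <= a -> a <= b -> a `^ alpha <= b `^ alpha.
  move=> a0 ab; apply: ge0_ler_powR => //; rewrite ?nnegrE ?(ltW alpha0)//.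
  exact: le_trans ab.
apply/andP; split.
  have [j jN zj] := set_valP z n.+1.
  apply: (@le_trans _ _ (hausdorff_measure alpha (cylinder n.+1 j))); last first.
    apply: hausdorff_measure_sub => y yj; rewrite ballEmdist /=.
    rewrite -lte_fin; apply: le_lt_trans (le_mdist_diam (zj : cylinder n.+1 j z) yj) _.
    by apply: le_lt_trans (diam_cylinder _ _) _; rewrite lte_fin.
  apply: le_trans (le_hausdorff_cylinder jN); rewrite lee_fin.
  have := mono _ _ (ltW e0) rne; rewrite scl => le.
  have -> : (2 * r n.+1) `^ alpha / (2 * N%:R) =
      (2 * N%:R ^+ 2)^-1 * (N%:R * (2 * r n.+1) `^ alpha).
    by field; rewrite gt_eqF.
  by rewrite ler_wpM2l// invr_ge0 mulr_ge0// exprn_ge0// ltW.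
have [j jN zj] := set_valP z n.
apply: (@le_trans _ _ (hausdorff_measure alpha (cylinder n j))).
  apply: hausdorff_measure_sub => y; rewrite ballEmdist /= => zy.
  by apply: same_cylinder jN zj _; exact: lt_le_trans zy rne.
apply: le_trans (hausdorff_cylinder_le jN) _; rewrite lee_fin scl.
by rewrite ler_pM2l//; apply: mono; rewrite ?mulr_ge0 ?ltW.
Qed.

End cantor_set.

(** * Choice of the parameters and conclusion *)

Theorem theorem1 (R : realType) (X : metricType R) (Q alpha : R) :
  0 < Q -> complete_space X -> ahlfors_regular X Q ->
  0 < alpha -> alpha < Q ->
  exists Y : set X, closed Y /\ ahlfors_regular (set_type Y) alpha.
Proof.
move=> Q0 Xc [[x0 [x1 /eqP x01]] [c [C [c0 [cC reg]]]]] alpha0 alphaQ.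
have C0 : 0 < C := lt_trans c0 cC.
(* The bound c / (C 8^Q) comes from 4 r_(k+1) = 8 lam (r_k / 2): it makes N balls of radius 4
   r_(k+1) too small in measure to cover a ball of radius r_k / 2. *)
have [N [lam [N1 lam0 lam4 Nlam NlamQ]]] := exists_similarity_ratio alpha0 alphaQ
  (divr_gt0 c0 (mulr_gt0 C0 (powR_gt0 Q (ltr0n R 8)))).
(* Starting from the distance of two points of [X] keeps every radius in use at most the diameter,
   where regularity applies. *)
pose r k := mdist x0 x1 * lam ^+ k.
have r0 k : 0 < r k by rewrite mulr_gt0 ?exprn_gt0// mdist_gt0.
have rS k : r k.+1 = lam * r k by rewrite /r exprS mulrCA.
have r4 k : 4 * r k.+1 <= r k by rewrite rS; have := r0 k; nra.
have rN k : N%:R * r k.+1 `^ alpha = r k `^ alpha.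
  by rewrite rS powRM ?(ltW (r0 _)) ?(ltW lam0)// mulrA Nlam mul1r.
have rX k a : a <= r k -> (a%:E <= diam [set: X])%E.
  move=> ar; apply: (@le_trans _ _ (mdist x0 x1)%:E); last exact: le_mdist_diam.
  rewrite lee_fin (le_trans ar)//; elim: k {ar} => [|k]; first by rewrite /r mulr1.
  by apply: le_trans; have := r4 k; have := r0 k.+1; lra.
have [|p [p_child p_sep]] := @exists_tree _ _ N r x0 (ltnW N1) r0 r4.
  move=> k x; apply: (separated_family Q0 C0 reg) => //.
  - by rewrite divr_gt0.
  - by apply: (rX k); have := r0 k; lra.
  - by rewrite mulr_gt0.
  - exact: rX (r4 k).
  have -> : 4 * r k.+1 = 8 * lam * (r k / 2) by rewrite rS; field.
  have : 0 < r k / 2 by rewrite divr_gt0.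
  move: (r k / 2) => h h0; rewrite !powRM ?mulr_ge0 ?(ltW h0) ?(ltW lam0)//.
  move: NlamQ; rewrite ltr_pdivlMr ?mulr_gt0 ?powR_gt0// => NlamQ.
  have -> : N%:R * (C * (8 `^ Q * lam `^ Q * h `^ Q)) =
      N%:R * lam `^ Q * (C * 8 `^ Q) * h `^ Q by ring.
  by rewrite ltr_pM2r// powR_gt0.
exists (cantor_set N r p); split; first exact: closed_cantor_set.
exact: ahlfors_regular_cantor_set.
Qed.
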